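(* Let $\mathrm{CS}$ be a constant specification for $\mathsf{JTO}$ with $\mathrm{CS}^{\mathcal O}=\emptyset$. Define $$\mathtt{contract}':=\boxdot\big[\big((\bigcirc\neg[\mathtt a]^{\mathcal O}_e\mathtt{pay})\,\mathcal W\,\mathtt{winfirst}_e\big)\wedge\big(\mathtt{winfirst}_e\to((\bigcirc[\mathtt a]^{\mathcal O}_e\mathtt{pay})\,\mathcal W\,\mathtt{pay})\big)\big],$$ $$\mathtt{court}':=\mathtt{true}_{10}\big[(\neg\mathtt{win}_p\leftrightarrow\mathtt{winfirst}_e)\wedge(\mathtt{win}_p\to((\bigcirc[\mathtt v_p]^{\mathcal O}_e\mathtt{pay})\,\mathcal W\,\mathtt{pay}))\wedge(\neg\mathtt{win}_p\to\Box\neg[\mathtt v_e]^{\mathcal O}_e\mathtt{pay})\big].$$ Then the set $\{\mathtt{contract}',\ \mathtt{court}',\ \mathtt{time}=10,\ \mathtt{true}_{10}(\neg\mathtt{pay})\}$ is consistent in $\mathsf{JTO}_{\mathrm{CS}}$, i.e. it does not derive $\bot$ in $\mathsf{JTO}_{\mathrm{CS}}$.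
   Context: **Language.** The set of agents is $\mathrm{Ag}=\{p,e,j\}$ (Protagoras, Euathlus, judge); $\mathrm{Const},\mathrm{Var},\mathrm{Prop}$ are countable sets of justification constants, justification variables and atomic propositions. $\mathrm{Prop}$ contains distinct atoms $\mathtt{win}_p$, $\mathtt{winfirst}_e$, $\mathtt{pay}$, and $\mathrm{Var}$ contains distinct variables $\mathtt a$ (the agreement), $\mathtt v_p$, $\mathtt v_e$ (the judge's verdict in favor of Protagoras, resp. Euathlus). Epistemic terms: $t::=c\mid x\mid {!t}\mid t+t\mid t\cdot t$. Normative terms: $s::=c\mid x\mid \ddagger s\mid s\cdot s$ ($c\in\mathrm{Const}$, $x\in\mathrm{Var}$). Formulas: $\varphi::=q\mid\bot\mid\varphi\to\varphi\mid\bigcirc\varphi\mid\mathsf Y_w\varphi\mid\varphi\,\mathcal U\,\varphi\mid\varphi\,\mathcal S\,\varphi\mid[t]_i\varphi\mid[s]^{\mathcal O}_i\varphi$ ($q\in\mathrm{Prop}$, $i\in\mathrm{Ag}$, $t$ epistemic, $s$ normative). Abbreviations: $\neg\varphi:=\varphi\to\bot$, $\top:=\neg\bot$, $\varphi\vee\psi:=\neg\varphi\to\psi$, $\varphi\wedge\psi:=\neg(\neg\varphi\vee\neg\psi)$, $\leftrightarrow$ as usual, $\mathsf Y_s\varphi:=\neg\mathsf Y_w\neg\varphi$, $\Diamond\varphi:=\top\,\mathcal U\,\varphi$, $\Box\varphi:=\neg\Diamond\neg\varphi$, $\blacksquare\varphi:=\neg(\top\,\mathcal S\,\neg\varphi)$,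 $\boxdot\varphi:=\blacksquare\varphi\wedge\Box\varphi$, $\varphi\,\mathcal W\,\psi:=(\varphi\,\mathcal U\,\psi)\vee\Box\varphi$, $\langle s\rangle^{\mathcal P}_i\varphi:=\neg[s]^{\mathcal O}_i\neg\varphi$; for $m\in\mathbb N$, $(\mathtt{time}=m):=\mathsf Y_s^m\mathsf Y_w\bot$ ($m$-fold $\mathsf Y_s$) and $\mathtt{true}_m(\varphi):=\boxdot(\mathtt{time}=m\to\varphi)$. **Axioms** (all instances, all $i\in\mathrm{Ag}$): propositional tautologies; $\ast(\varphi\to\psi)\to(\ast\varphi\to\ast\psi)$ for $\ast\in\{\bigcirc,\Box,\blacksquare,\mathsf Y_w\}$; $\bigcirc\neg\varphi\leftrightarrow\neg\bigcirc\varphi$; $\Box(\varphi\to\bigcirc\varphi)\to(\varphi\to\Box\varphi)$; $\varphi\,\mathcal U\,\psi\to\Diamond\psi$; $\varphi\,\mathcal U\,\psi\leftrightarrow\psi\vee(\varphi\wedge\bigcirc(\varphi\,\mathcal U\,\psi))$; $\mathsf Y_s\varphi\to\mathsf Y_w\varphi$; $\top\,\mathcal S\,\mathsf Y_w\bot$; $\blacksquare(\varphi\to\mathsf Y_w\varphi)\to(\varphi\to\blacksquare\varphi)$; $(\varphi\,\mathcal S\,\psi)\to(\top\,\mathcal S\,\psi)$; $\varphi\,\mathcal S\,\psi\leftrightarrow\psi\vee(\varphi\wedge\mathsf Y_s(\varphi\,\mathcal S\,\psi))$; $\varphi\to\bigcirc\mathsf Y_s\varphi$; $\varphi\to\mathsf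 Y_w\bigcirc\varphi$; $[t]_i(\varphi\to\psi)\to([s]_i\varphi\to[t\cdot s]_i\psi)$; $[t]_i\varphi\to[t+s]_i\varphi$; $[s]_i\varphi\to[t+s]_i\varphi$; $[t]_i\varphi\to\varphi$; $[t]_i\varphi\to[!t]_i[t]_i\varphi$; $[t]^{\mathcal O}_i(\varphi\to\psi)\to([s]^{\mathcal O}_i\varphi\to[t\cdot s]^{\mathcal O}_i\psi)$; $[t]^{\mathcal O}_i\varphi\to\langle t\rangle^{\mathcal P}_i\varphi$; $[\ddagger t]^{\mathcal O}_i([t]^{\mathcal O}_i\varphi\to\varphi)$. **Constant specifications.** A constant specification $\mathrm{CS}$ is a set of formulas of the form $[c_n]_{i_n}\cdots[c_1]_{i_1}\varphi$ or $[c_n]^{\mathcal O}_{i_n}\cdots[c_1]^{\mathcal O}_{i_1}\varphi$ with $n\ge1$, $c_k\in\mathrm{Const}$, $i_k\in\mathrm{Ag}$, $\varphi$ an axiom instance, which is downward closed: for $n>1$, if such a formula is in $\mathrm{CS}$, so is the one obtained by deleting its outermost operator. $\mathrm{CS}^{\mathcal O}$ is the subset of elements of the second form. **Derivability.** $\vdash_{\mathrm{CS}}$ is derivability in the Hilbert system $\mathsf{JTO}_{\mathrm{CS}}$ with these axioms, modus ponens, necessitation (from $\vdash\varphi$ infer $\vdash\ast\varphi$) for $\ast\in\{\bigcirc,\mathsf Y_w,\Box,\blacksquare\}$, and: infer $\vdash\varphi$ for each $\varphi\in\mathrm{CS}$. $T\vdash_{\mathrm{CS}}\varphi$ means $\vdash_{\mathrm{CS}}(\psi_1\wedge\dots\wedge\psi_k)\to\varphi$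 for some $\psi_1,\dots,\psi_k\in T$. *)

(* Defs.v *)
From Stdlib Require List.
From mathcomp Require Import all_boot.

Set Implicit Arguments.
Unset Strict Implicit.
Unset Printing Implicit Defensive.

Inductive agent : Type := Protagoras | Euathlus | Judge.

Inductive eterm (Const Var : Type) : Type :=
| ECst of Const
| EVar of Var
| EBang of eterm Const Var
| ESum of eterm Const Var & eterm Const Var
| EApp of eterm Const Var & eterm Const Var.

Inductive nterm (Const Var : Type) : Type :=
| NCst of Const
| NVar of Var
| NDag of nterm Const Var
| NApp of nterm Const Var & nterm Const Var.

Arguments ECst {Const Var}.
Arguments EVar {Const Var}.
Arguments NCst {Const Var}.
Arguments NVar {Const Var}.

(* [EJ t i f] is [t]_i f and [NJ s i f] is [s]^O_i f. *)
Inductive form (Const Var Atom : Type) : Type :=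
| At of Atom
| Bot
| Imp of form Const Var Atom & form Const Var Atom
| Next of form Const Var Atom
| Yw of form Const Var Atom
| Until of form Const Var Atom & form Const Var Atom
| Since of form Const Var Atom & form Const Var Atom
| EJ of eterm Const Var & agent & form Const Var Atom
| NJ of nterm Const Var & agent & form Const Var Atom.

Arguments At {Const Var Atom}.
Arguments Bot {Const Var Atom}.

Declare Scope jto_scope.
Delimit Scope jto_scope with F.
Bind Scope jto_scope with form.
Local Open Scope jto_scope.

Notation "f ~> g" := (Imp f g)
  (at level 60, right associativity) : jto_scope.

Section Abbreviations.
Variables Const Var Atom : Type.
Local Notation fm := (form Const Var Atom).
Implicit Types f g : fm.

Definition Neg f : fm := f ~> Bot.
Definition Top : fm := Neg Bot.
Definition Or f g : fm := Neg f ~> g.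
Definition And f g : fm := Neg (Or (Neg f) (Neg g)).
Definition Iff f g : fm := And (f ~> g) (g ~> f).
Definition Ys f : fm := Neg (Yw (Neg f)).
Definition Diamond f : fm := Until Top f.
Definition Box f : fm := Neg (Diamond (Neg f)).
Definition HBox f : fm := Neg (Since Top (Neg f)).
Definition Boxdot f : fm := And (HBox f) (Box f).
Definition WUntil f g : fm := Or (Until f g) (Box f).
Definition NPerm (s : nterm Const Var) (i : agent) f : fm := Neg (NJ s i (Neg f)).
Definition time (m : nat) : fm := iter m Ys (Yw Bot).
Definition true_at (m : nat) f : fm := Boxdot (time m ~> f).

Fixpoint bigAnd (fs : seq fm) : fm :=
  match fs with
  | [::] => Top
  | [:: f] => f
  | f :: fs' => And f (bigAnd fs')
  end.

End Abbreviations.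

Arguments Top {Const Var Atom}.
Arguments time {Const Var Atom}.

Notation "~: f" := (Neg f) (at level 35, right associativity) : jto_scope.
Notation "f :/\ g" := (And f g)
  (at level 40, left associativity) : jto_scope.
Notation "f :\/ g" := (Or f g)
  (at level 50, left associativity) : jto_scope.
Notation "f <~> g" := (Iff f g) (at level 65, no associativity) : jto_scope.

Section ProofSystem.
Variables Const Var Atom : Type.
Local Notation fm := (form Const Var Atom).
Implicit Types (f g : fm) (CS T : fm -> Prop).

(* Every formula that is neither [Bot] nor an implication counts as a
   propositional variable. *)
Fixpoint prop_eval (v : fm -> bool) f : bool :=
  match f with
  | Bot => false
  | g ~> h => prop_eval v g ==> prop_eval v h
  | _ => v f
  end.

Definition tautology f : Prop := forall v : fm -> bool, prop_eval v f.

Inductive normal_modality : (fm -> fm) -> Prop :=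
| nm_Next : normal_modality (@Next Const Var Atom)
| nm_Box : normal_modality (@Box Const Var Atom)
| nm_HBox : normal_modality (@HBox Const Var Atom)
| nm_Yw : normal_modality (@Yw Const Var Atom).

Inductive axiom : fm -> Prop :=
| ax_taut f : tautology f -> axiom f
| ax_K star f g : normal_modality star ->
    axiom (star (f ~> g) ~> star f ~> star g)
| ax_fun f : axiom (Next (~: f) <~> ~: Next f)
| ax_ind f : axiom (Box (f ~> Next f) ~> f ~> Box f)
| ax_U1 f g : axiom (Until f g ~> Diamond g)
| ax_U2 f g : axiom (Until f g <~> g :\/ (f :/\ Next (Until f g)))
| ax_sw f : axiom (Ys f ~> Yw f)
| ax_initial : axiom (Since Top (Yw Bot))
| ax_past_ind f : axiom (HBox (f ~> Yw f) ~> f ~> HBox f)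
| ax_S1 f g : axiom (Since f g ~> Since Top g)
| ax_S2 f g : axiom (Since f g <~> g :\/ (f :/\ Ys (Since f g)))
| ax_FP f : axiom (f ~> Next (Ys f))
| ax_PF f : axiom (f ~> Yw (Next f))
| ax_Eapp t s i f g :
    axiom (EJ t i (f ~> g) ~> EJ s i f ~> EJ (EApp t s) i g)
| ax_Esuml t s i f : axiom (EJ t i f ~> EJ (ESum t s) i f)
| ax_Esumr t s i f : axiom (EJ s i f ~> EJ (ESum t s) i f)
| ax_Efact t i f : axiom (EJ t i f ~> f)
| ax_Ebang t i f : axiom (EJ t i f ~> EJ (EBang t) i (EJ t i f))
| ax_Napp t s i f g :
    axiom (NJ t i (f ~> g) ~> NJ s i f ~> NJ (NApp t s) i g)
| ax_Nnoc t i f : axiom (NJ t i f ~> NPerm t i f)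
| ax_Ndag t i f : axiom (NJ (NDag t) i (NJ t i f ~> f)).

(* [Echain [:: (c_n, i_n); ...; (c_1, i_1)] f] is [c_n]_{i_n} ... [c_1]_{i_1} f,
   the head of the list being the outermost operator. *)
Definition Echain (cs : seq (Const * agent)) f : fm :=
  foldr (fun ci g => EJ (ECst ci.1) ci.2 g) f cs.

Definition Nchain (cs : seq (Const * agent)) f : fm :=
  foldr (fun ci g => NJ (NCst ci.1) ci.2 g) f cs.

Definition Espec f : Prop :=
  exists cs g, [/\ 0 < size cs, axiom g & f = Echain cs g].

Definition Nspec f : Prop :=
  exists cs g, [/\ 0 < size cs, axiom g & f = Nchain cs g].

Definition downward_closed CS : Prop :=
  forall c i cs f, 0 < size cs -> axiom f ->
    (CS (Echain ((c, i) :: cs) f) -> CS (Echain cs f)) /\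
    (CS (Nchain ((c, i) :: cs) f) -> CS (Nchain cs f)).

Definition constant_specification CS : Prop :=
  (forall f, CS f -> Espec f \/ Nspec f) /\ downward_closed CS.

Definition normative_part CS : fm -> Prop := fun f => CS f /\ Nspec f.

Inductive derivable CS : fm -> Prop :=
| der_ax f : axiom f -> derivable CS f
| der_mp f g : derivable CS (f ~> g) -> derivable CS f -> derivable CS g
| der_nec star f : normal_modality star -> derivable CS f ->
    derivable CS (star f)
| der_cs f : CS f -> derivable CS f.

Definition derivable_from CS T f : Prop :=
  exists fs : seq fm, List.Forall T fs /\ derivable CS (bigAnd fs ~> f).

Definition consistent CS T : Prop := ~ derivable_from CS T Bot.

End ProofSystem.

Section CourtParadox.
Variables Const Var Atom : Type.
Local Notation fm := (form Const Var Atom).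

Definition contract' (winfirst_e pay : Atom) (a : Var) : fm :=
  Boxdot
    (WUntil (Next (~: NJ (NVar a) Euathlus (At pay))) (At winfirst_e) :/\
     (At winfirst_e ~>
        WUntil (Next (NJ (NVar a) Euathlus (At pay))) (At pay))).

Definition court' (win_p winfirst_e pay : Atom) (v_p v_e : Var) : fm :=
  true_at 10
    ((~: At win_p <~> At winfirst_e) :/\
     (At win_p ~>
        WUntil (Next (NJ (NVar v_p) Euathlus (At pay))) (At pay)) :/\
     (~: At win_p ~> Box (~: NJ (NVar v_e) Euathlus (At pay)))).

End CourtParadox.

Arguments contract' {Const Var Atom}.
Arguments court' {Const Var Atom}.

(* Main.v *)
(** Evaluate formulas over the single run 0, 1, 2, ..., collapsing the
    modalities: [t]_i f means f, and [s]^O_i f means f together with "s is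
    binding", where the only non-binding terms are the variables outside a
    given set.  All axioms of JTO are valid in such a model, and so are the
    members of CS, none of which is normative.  Now make v_p the only binding
    variable, let win_p hold always, winfirst_e never, and pay at every moment
    except 10: the four formulas hold at time 10, since Protagoras wins, the
    agreement never binds, and Euathlus pays at time 11. *)

Require Import Defs.
From mathcomp Require Import all_boot.
From mathcomp Require Import zify boolp.
From Stdlib Require List.

Set Implicit Arguments.
Unset Strict Implicit.
Unset Printing Implicit Defensive.

Section Model.
Variables (Const Var Atom : Type).
Variables (val : nat -> Atom -> Prop) (binding_var : Var -> Prop).
Local Notation fm := (form Const Var Atom).
Implicit Types (f g : fm) (m n : nat).

(** Compound terms always bind: [ax_Ndag] forces this for [NDag], and for [NApp] it makes [ax_Napp]
    valid. *)
Definition binding (s : nterm Const Var) : Prop :=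
  if s is NVar x then binding_var x else True.

Fixpoint sat n (f : fm) : Prop :=
  match f with
  | At q => val n q
  | Bot => False
  | Imp f g => sat n f -> sat n g
  | Next f => sat n.+1 f
  | Yw f => if n is m.+1 then sat m f else True
  | Until f g => exists2 m, n <= m &
      sat m g /\ forall k, n <= k < m -> sat k f
  | Since f g => exists2 m, m <= n &
      sat m g /\ forall k, m < k <= n -> sat k f
  | EJ _ _ f => sat n f
  | NJ s _ f => binding s /\ sat n f
  end.

(** Introduces an implication while keeping both sides in the form [sat n _], to which the lemmas on
    derived connectives apply. *)
Lemma sat_Imp n f g : (sat n f -> sat n g) -> sat n (Imp f g).
Proof. by []. Qed.

Lemma sat_And n f g : sat n (And f g) <-> sat n f /\ sat n g.
Proof. by rewrite /=; have [] := EM (sat n f); have [] := EM (sat n g); tauto. Qed.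

Lemma sat_Or n f g : sat n (Or f g) <-> sat n f \/ sat n g.
Proof. by rewrite /=; have [] := EM (sat n f); tauto. Qed.

Lemma sat_Iff n f g : sat n (Iff f g) <-> (sat n f <-> sat n g).
Proof. by rewrite sat_And /=; tauto. Qed.

Lemma sat_Ys n f : sat n (Ys f) <-> if n is m.+1 then sat m f else False.
Proof. by case: n => [|n] /=; [split=> // /(_ (fun _ => I)) | have [] := EM (sat n f); tauto]. Qed.

Lemma sat_Diamond n f : sat n (Diamond f) <-> exists2 m, n <= m & sat m f.
Proof. by split=> [[m le_nm [fm _]]|[m le_nm fm]]; exists m => //; split=> // k _ []. Qed.

Lemma sat_Box n f : sat n (Box f) <-> forall m, n <= m -> sat m f.
Proof.
split=> [nDf m le_nm | Bf]; last first.
  by move=> Df; have /sat_Diamond[m /Bf fm] := Df; apply.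
by have [//|nf] := EM (sat m f); case: nDf; apply/(sat_Diamond n (Neg f)); exists m.
Qed.

Lemma sat_SinceTop n f : sat n (Since Top f) <-> exists2 m, m <= n & sat m f.
Proof. by split=> [[m le_mn [fm _]]|[m le_mn fm]]; exists m => //; split=> // k _ []. Qed.

Lemma sat_HBox n f : sat n (HBox f) <-> forall m, m <= n -> sat m f.
Proof.
split=> [nPf m le_mn | Hf]; last first.
  by move=> Pf; have /sat_SinceTop[m /Hf fm] := Pf; apply.
by have [//|nf] := EM (sat m f); case: nPf; apply/(sat_SinceTop n (Neg f)); exists m.
Qed.

(** The past and the future of [n] together cover the whole run, so the choice of [n] does not
    matter. *)
Lemma sat_Boxdot n f : sat n (Boxdot f) <-> forall m, sat m f.
Proof.
rewrite sat_And sat_HBox sat_Box; split=> [[Hf Bf] m|Af]; last by split.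
by have [/Hf|/ltnW/Bf] := leqP m n.
Qed.

(** Each [Ys] steps back once and fails at 0, while [Yw Bot] holds only at 0. *)
Lemma sat_time n m : sat n (time m) <-> n = m.
Proof.
elim: m n => [|m IHm] n; first by case: n.
by rewrite /time iterS sat_Ys; case: n => [|n] //; rewrite IHm; split=> [->|[]].
Qed.

Lemma sat_true_at n m f : sat n (true_at m f) <-> sat m f.
Proof.
rewrite sat_Boxdot; split=> [/(_ m) /= fm|fm k /=]; first exact/fm/sat_time.
by move/sat_time->.
Qed.

Lemma sat_bigAnd n fs : List.Forall (sat n) fs -> sat n (bigAnd fs).
Proof.
elim=> {fs} [|f [|g fs] fn _ IH] //=; exact/sat_And.
Qed.

Lemma sat_tautology n f : tautology f -> sat n f.
Proof.
(* Deciding [sat n] classically yields a Boolean valuation of the propositional variables. *)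
have evalE g : prop_eval (fun h => `[<sat n h>]) g <-> sat n g.
  elim: g => //=; try by move=> *; split=> /asboolP.
  by move=> g IHg h IHh; rewrite -IHg -IHh; split=> /implyP.
by move=> /(_ (fun h => `[<sat n h>])) /evalE.
Qed.

Lemma sat_normal star f g n : normal_modality star ->
  sat n (star (Imp f g)) -> sat n (star f) -> sat n (star g).
Proof.
case=> [||| ]; first by apply.
- by rewrite !sat_Box => fg fn m le_nm; apply: fg (fn m le_nm).
- by rewrite !sat_HBox => fg fn m le_mn; apply: fg (fn m le_mn).
- by case: n => [|n] //=; apply.
Qed.

Lemma sat_nec star f : normal_modality star ->
  (forall n, sat n f) -> forall n, sat n (star f).
Proof.
by case=> fT n; rewrite ?sat_Box ?sat_HBox //=; case: n.
Qed.

Lemma sat_Until_unfold n f g :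
  sat n (Until f g) <-> sat n g \/ (sat n f /\ sat n.+1 (Until f g)).
Proof.
split=> /= [[m le_nm [gm fnm]]|[gn|[fn [m lt_nm [gm fnm]]]]].
- have [e|lt_nm] := eqVneq n m; first by left; rewrite e.
  right; split; first by apply: fnm; lia.
  by exists m; [lia | split=> // k ?; apply: fnm; lia].
- by exists n => //; split=> // k; lia.
- exists m; [lia | split=> // k ?].
  by have [->//|ne_kn] := eqVneq k n; apply: fnm; lia.
Qed.

Lemma sat_Since_unfold n f g :
  sat n (Since f g) <-> sat n g \/ (sat n f /\ sat n (Ys (Since f g))).
Proof.
rewrite sat_Ys; split=> /= [[m le_mn [gm fmn]]|].
- have [<-|ne_mn] := eqVneq m n; first by left.
  right; split; first by apply: fmn; lia.
  (* At moment 0 the only possible witness is 0 itself, which is excluded here. *)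
  case: n le_mn fmn ne_mn => [|n] le_mn fmn ne_mn; first lia.
  by exists m; [lia | split=> // k ?; apply: fmn; lia].
- case=> [gn|[fn]]; first by exists n => //; split=> // k; lia.
  case: n fn => [//|n] fn [m le_mn [gm fmn]].
  exists m; [lia | split=> // k ?].
  by have [->//|ne_kn] := eqVneq k n.+1; apply: fmn; lia.
Qed.

Lemma sat_axiom f : axiom f -> forall n, sat n f.
Proof.
case=> {f}.
- by move=> f tf n; apply: sat_tautology.
- by move=> star f g nstar n; apply: sat_normal.
(* Both sides say that [f] fails at the unique next moment. *)
- by move=> f n; apply/sat_Iff.
- move=> f n; apply: sat_Imp => /sat_Box step.
  apply: sat_Imp => fn; apply/sat_Box; elim=> [|m IHm] le_nm.
    by move: le_nm fn; rewrite leqn0 => /eqP->.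
  have [<-//|ne_nm] := eqVneq n m.+1.
  by apply: step (IHm _); lia.
- by move=> f g n [m le_nm [gm _]]; apply/sat_Diamond; exists m.
- by move=> f g n; rewrite sat_Iff sat_Or sat_And; apply: sat_Until_unfold.
- by move=> f n; apply: sat_Imp => /sat_Ys; case: n.
- by move=> n; apply/sat_SinceTop; exists 0.
- move=> f n; apply: sat_Imp => /sat_HBox step.
  apply: sat_Imp => fn; apply/sat_HBox => m.
  (* Induction on the present moment: [step] at [n.+1] carries [f] back to [n]. *)
  elim: n step fn => [|n IHn] step fn le_mn.
    by move: le_mn; rewrite leqn0 => /eqP->.
  have [->//|ne_mn] := eqVneq m n.+1.
  apply: IHn; [by move=> k le_kn; apply: step; lia | | lia].
  exact: (step n.+1).
- by move=> f g n [m le_mn [gm _]]; apply/sat_SinceTop; exists m.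
- by move=> f g n; rewrite sat_Iff sat_Or sat_And; apply: sat_Since_unfold.
- by move=> f n fn; apply/(sat_Ys n.+1).
- by move=> f [|n].
- by move=> t s i f g n; apply.
- by move=> t s i f n; apply: sat_Imp.
- by move=> t s i f n; apply: sat_Imp.
- by move=> t i f n; apply: sat_Imp.
- by move=> t i f n; apply: sat_Imp.
- by move=> t s i f g n [_ fg] [_ fn]; split=> //; apply: fg.
(* What is obligatory is true, so [f] and its negation cannot both be obligatory. *)
- by move=> t i f n [_ fn] [_]; apply.
- by move=> t i f n; split=> // -[].
Qed.

Lemma sat_Echain n cs f : sat n (Echain cs f) <-> sat n f.
Proof. by elim: cs. Qed.

(** Truth is claimed at all moments together, because necessitation refers to moments other than the
    current one. *)
Lemma soundness (CS : fm -> Prop) : (forall f, CS f -> Espec f) ->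
  forall f, derivable CS f -> forall n, sat n f.
Proof.
move=> CSE f; elim=> {f} [f /sat_axiom //|f g _ fg _ fT n||f CSf n].
- exact/fg/fT.
- by move=> star f nstar _; apply: sat_nec.
- by have [cs [g [_ ax_g ->]]] := CSE f CSf; apply/sat_Echain/sat_axiom.
Qed.

Lemma satisfiable_consistent (CS T : fm -> Prop) n :
  (forall f, CS f -> Espec f) -> (forall f, T f -> sat n f) ->
  consistent CS T.
Proof.
move=> CSE satT [fs [Tfs /(soundness CSE)/(_ n)]]; apply; apply: sat_bigAnd.
exact: List.Forall_impl Tfs.
Qed.

End Model.

Theorem lemma7p4 (Const Var Atom : countType)
    (win_p winfirst_e pay : Atom) (a v_p v_e : Var)
    (atoms_distinct : uniq [:: win_p; winfirst_e; pay])
    (vars_distinct : uniq [:: a; v_p; v_e])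
    (CS : form Const Var Atom -> Prop)
    (CS_spec : constant_specification CS)
    (CS_norm_empty : forall f, ~ normative_part CS f) :
  consistent CS (fun f : form Const Var Atom =>
    [\/ f = contract' winfirst_e pay a,
        f = court' win_p winfirst_e pay v_p v_e,
        f = time 10
      | f = true_at 10 (Neg (At pay))]).
Proof.
have [ne_wf ne_wp ne_fp] :
    [/\ win_p <> winfirst_e, win_p <> pay & winfirst_e <> pay].
  by move: atoms_distinct; rewrite /= !inE negb_or andbT
    => /andP[/andP[/eqP ? /eqP ?] /eqP ?].
have ne_avp : a <> v_p.
  by move: vars_distinct; rewrite /= !inE negb_or => /andP[/andP[/eqP ? _] _].
(* Atoms other than [winfirst_e] and [pay], [win_p] among them, are true at every moment. *)
pose val n q := q <> winfirst_e /\ (q = pay -> n <> 10).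
apply: (@satisfiable_consistent _ _ _ val (eq v_p) _ _ 10) => f.
  by move=> CSf; have [//|Nf] := CS_spec.1 f CSf; case: (CS_norm_empty f).
case=> ->.
(* The weak until holds through its [Box] disjunct, as [a] never binds; the other clause has the
   false premise [winfirst_e]. *)
- apply/sat_Boxdot => m; apply/sat_And; split; last by case.
  by apply/sat_Or; right; apply/sat_Box => k _ [/esym].
- have win_m m : val m win_p by split.
  apply/sat_true_at; rewrite 2!sat_And sat_Iff; split; last first.
    by apply: sat_Imp => /(_ (win_m _)).
  split; first by split=> [/(_ (win_m _))|[]].
  have pay11 : val 11 pay by split=> // /esym.
  (* The payment at 11 is the witness. Only moment 10 remains to be checked, and at its successor 11
     the obligation under [v_p] holds. *)
  move=> _; apply/sat_Or; left; exists 11 => //; split=> // k k_bounds.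
  by have -> : k = 10 by lia.
- exact/sat_time.
- by apply/sat_true_at => -[_]; apply.
Qed.
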